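(* Let $(\boldsymbol{\lambda}^*,\boldsymbol{\theta}^* )\in\Delta_r\times\Delta_{\mathcal{A}}$ and let $\mathcal{I}=\{i\in\{1,\dots,r\}: \lambda_i^*\neq 0\}$. Then $(\boldsymbol{\lambda}^*,\boldsymbol{\theta}^* )$ is a Nash equilibrium of the surveillance-evasion game if and only if the following three conditions hold: 1. $\boldsymbol{\lambda}^*$ is a maximizer of $G$ over $\Delta_r$, where $G(\boldsymbol{\lambda})=\min_{\mathbf{a}(\cdot)\in\mathcal{A}}\sum_{i=1}^r\lambda_i\mathcal{J}_i(\mathbf{a}(\cdot))$; 2. if $i\in\mathcal{I}$, then $\mathbb{E}_{\boldsymbol{\theta}^*}[\mathcal{J}_i(\mathbf{a}(\cdot))]=G(\boldsymbol{\lambda}^* )$; and 3. if $i\notin\mathcal{I}$, then $\mathbb{E}_{\boldsymbol{\theta}^*}[\mathcal{J}_i(\mathbf{a}(\cdot))]\le G(\boldsymbol{\lambda}^* )$.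
   Context: Setting. $\Omega\subset\mathbb{R}^d$ is compact, $\mathbf{x}_S,\mathbf{x}_T\in\Omega$ are fixed (start and target of an evader E), and $A=\{\mathbf{a}\in\mathbb{R}^d: |\mathbf{a}|=1\}$. A control is a measurable function $\mathbf{a}:\mathbb{R}\to A$; the evader's trajectory is $\mathbf{y}'(t)=f(\mathbf{y}(t))\,\mathbf{a}(t)$, $\mathbf{y}(0)=\mathbf{x}_S$, with $f$ a given speed function, and $T_{\mathbf{a}}=\min\{t\ge 0: \mathbf{y}(t)=\mathbf{x}_T\}$. $\mathcal{A}$ denotes the set of admissible controls, i.e. those with $T_{\mathbf{a}}<\infty$ and $\mathbf{y}(t)\in\Omega$ for all $t\in[0,T_{\mathbf{a}}]$. An observer O has $r$ possible locations; the $i$-th has a positive pointwise observability function $K_i:\Omega\to(0,\infty)$, and the corresponding cumulative observability of a control is $$\mathcal{J}_i(\mathbf{a}(\cdot))=\int_0^{T_{\mathbf{a}}}K_i(\mathbf{y}(t))\,dt .$$ The functions $f$ and $K_i$ are understood to be regular enough that trajectories and these (finite) integrals are well defined, and the set $\mathcal{A}$ is nonempty; the minimum defining $G(\boldsymbol{\lambda})$ is understood to be attained for each $\boldsymbol{\lambda}\in\Delta_r$. Surveillance-evasion game. $\Delta_r=\{\boldsymbol{\lambda}=(\lambda_1,\dots,\lambda_r): \lambda_i\ge 0,\ \sum_{i=1}^r\lambda_i=1\}$ is the set of O's mixed strategies, and $\Delta_{\mathcal{A}}$ is the set of E's mixed strategies, i.e. probability distributions $\boldsymbol{\theta}$ over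 $\mathcal{A}$ (with the $\mathcal{J}_i$ measurable); pure strategies $\mathbf{a}(\cdot)\in\mathcal{A}$ are identified with point masses in $\Delta_{\mathcal{A}}$. For $\boldsymbol{\lambda}\in\Delta_r$ set $\mathcal{J}^{\boldsymbol{\lambda}}=\sum_{i=1}^r\lambda_i\mathcal{J}_i$. The payoff is $P(\boldsymbol{\lambda},\boldsymbol{\theta})=\mathbb{E}_{\boldsymbol{\theta}}[\mathcal{J}^{\boldsymbol{\lambda}}(\mathbf{a}(\cdot))]$, the expectation being over $\mathbf{a}(\cdot)$ drawn from $\boldsymbol{\theta}$; O maximizes and E minimizes $P$. A pair $(\boldsymbol{\lambda}^*,\boldsymbol{\theta}^* )\in\Delta_r\times\Delta_{\mathcal{A}}$ is a Nash equilibrium if $P(\boldsymbol{\lambda}^*,\boldsymbol{\theta}^* )\le P(\boldsymbol{\lambda}^*,\boldsymbol{\theta})$ for all $\boldsymbol{\theta}\in\Delta_{\mathcal{A}}$ and $P(\boldsymbol{\lambda}^*,\boldsymbol{\theta}^* )\ge P(\boldsymbol{\lambda},\boldsymbol{\theta}^* )$ for all $\boldsymbol{\lambda}\in\Delta_r$. *)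

(* Defs.v *)
From HB Require Import structures.
From mathcomp Require Import all_boot all_order all_algebra.
From mathcomp Require Import all_classical all_reals all_analysis.

Set Implicit Arguments.
Unset Strict Implicit.
Unset Printing Implicit Defensive.

Import Order.TTheory GRing.Theory Num.Theory.
Import numFieldNormedType.Exports.

Local Open Scope classical_set_scope.
Local Open Scope ring_scope.

(* The default value 0 is returned only when S has no least element. *)
Definition minimum (R : realType) (S : set R) : R :=
  xget 0 (S `&` lbound S).

(* The norm of the library on row vectors is the sup norm. *)
Definition euclidean_norm (R : realType) (n : nat) (v : 'rV[R]_n) : R :=
  Num.sqrt (\sum_i v 0 i ^+ 2).

(* Absolute continuity on every [0, T]: the ]u k, v k[ are pairwise disjoint
   subintervals of [0, T]. *)
Definition locally_absolutely_continuous (R : realType) (n : nat)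
    (y : R -> 'rV[R]_n) : Prop :=
  forall T e : R, 0 < T -> 0 < e -> exists2 delta : R, 0 < delta &
    forall (m : nat) (u v : 'I_m -> R),
      (forall k, [/\ 0 <= u k, u k <= v k & v k <= T]) ->
      (forall k l, k != l -> v k <= u l \/ v l <= u k) ->
      \sum_k (v k - u k) < delta ->
      \sum_k `|y (v k) - y (u k)| < e.

(* Functions on Omega are represented by total functions on R^n; only the
   restriction of the observabilities to Omega is ever used. *)
Record scenario (R : realType) (n r : nat) := Scenario {
  domain : set 'rV[R]_n;
  source : 'rV[R]_n;
  target : 'rV[R]_n;
  speed : 'rV[R]_n -> R;
  observability : 'I_r -> 'rV[R]_n -> R
}.

Section Game.
Context (R : realType) (n r : nat) (S : scenario R n r).
Implicit Types (a y : R -> 'rV[R]_n) (l : 'I_r -> R).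

(* Measurability into R^n, coordinate by coordinate. *)
Definition control a : Prop :=
  (forall i, measurable_fun [set: R] (fun t => a t 0 i)) /\
  (forall t, euclidean_norm (a t) = 1).

(* Caratheodory solution of y' = f(y) a, y(0) = x_S on [0, +oo[, since a is
   only measurable; the values of y at negative times are irrelevant. *)
Definition is_trajectory a y : Prop :=
  [/\ y 0 = source S,
      locally_absolutely_continuous y &
      {ae @lebesgue_measure R, forall t : R, 0 < t ->
        is_derive t (1 : R) y (speed S (y t) *: a t)}].

Definition trajectories_well_defined : Prop :=
  forall a, control a ->
    (exists y, is_trajectory a y) /\
    (forall y1 y2, is_trajectory a y1 -> is_trajectory a y2 ->
       forall t, 0 <= t -> y1 t = y2 t).

Definition trajectory a : R -> 'rV[R]_n :=
  xget (fun=> source S) [set y | is_trajectory a y].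

Definition arrivals a : set R :=
  [set t | 0 <= t /\ trajectory a t = target S].

(* Meaningful when arrivals a is nonempty, i.e. when T_a is finite. *)
Definition arrival_time a : R := minimum (arrivals a).

Definition admissible : set (R -> 'rV[R]_n) :=
  [set a | [/\ control a, arrivals a !=set0 &
    forall t, 0 <= t <= arrival_time a -> domain S (trajectory a t)]].

Definition integrals_well_defined : Prop :=
  forall i a, admissible a ->
    (@lebesgue_measure R).-integrable `[0, arrival_time a]
      (fun t => (observability S i (trajectory a t))%:E).

Definition cumulative_observability (i : 'I_r) a : R :=
  \int[@lebesgue_measure R]_(t in `[0, arrival_time a])
    observability S i (trajectory a t).

Definition simplex : set ('I_r -> R) :=
  [set l | (forall i, 0 <= l i) /\ \sum_i l i = 1].

Definition active_locations l : set 'I_r := [set i | l i != 0].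

Definition mixed_observability l a : R :=
  \sum_i l i * cumulative_observability i a.

Definition minima_attained : Prop :=
  forall l, simplex l -> exists2 a, admissible a &
    forall b, admissible b -> mixed_observability l a <= mixed_observability l b.

Definition G l : R := minimum [set mixed_observability l a | a in admissible].

(* The set of admissible controls as a type; the proof of nonemptiness
   provides the point that measurable types must have. *)
Definition strategy (hA : admissible !=set0) : Type := set_type admissible.

Section Strategies.
Context (hA : admissible !=set0).

HB.instance Definition _ := gen_eqMixin (strategy hA).
HB.instance Definition _ := gen_choiceMixin (strategy hA).
HB.instance Definition _ := isPointed.Build (strategy hA)
  (exist _ (projT1 (cid hA)) (mem_set (projT2 (cid hA)))).

(* A sigma-algebra on the set of admissible controls is given by a generating
   family F (possibly the whole sigma-algebra). *)
Context (F : set (set (strategy hA))).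

Definition costs_measurable : Prop :=
  forall i, measurable_fun [set: g_sigma_algebraType F]
    (fun w : g_sigma_algebraType F => cumulative_observability i (sval w)).

Definition mixed_strategy : Type := probability (g_sigma_algebraType F) R.

Definition expected_observability (i : 'I_r) (theta : mixed_strategy) : \bar R :=
  'E_theta[fun w => cumulative_observability i (sval w)]%E.

Definition payoff l (theta : mixed_strategy) : \bar R :=
  'E_theta[fun w => mixed_observability l (sval w)]%E.

Definition nash_equilibrium l (theta : mixed_strategy) : Prop :=
  [/\ simplex l,
      forall theta' : mixed_strategy, (payoff l theta <= payoff l theta')%E &
      forall l', simplex l' -> (payoff l' theta <= payoff l theta)%E].

End Strategies.
End Game.

(* Main.v *)
(** Write [x_i] for the expected observability of location [i] under [theta].
    It lies in [[0, +oo]] because the costs are nonnegative, so the payoff is the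
    sum of the [l_i x_i] without any integrability assumption. Every mixed
    strategy costs the evader at least [G l] against [l], and a point mass at a
    minimizing control costs exactly [G l]; hence at equilibrium the payoff is
    [G lambda], and testing against the vertices of the simplex gives
    [x_i <= G lambda]. As the average of the [x_i] with weights [lambda_i] is
    [G lambda], equality holds wherever [lambda_i] is nonzero. *)

Require Import Defs.
From mathcomp Require Import all_boot all_order all_algebra.
From mathcomp Require Import all_classical all_reals all_analysis.
From mathcomp Require Import measurable_realfun.
Import Order.TTheory GRing.Theory Num.Theory.
Import numFieldNormedType.Exports.
Local Open Scope classical_set_scope.
Local Open Scope ring_scope.

(** By antisymmetry a least element is unique, so the choice made by [xget] cannot matter. *)
Lemma minimumE (R : realType) (A : set R) (x : R) :
  A x -> lbound A x -> minimum A = x.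
Proof.
move=> Ax lbx; have [Am lbm] : (A `&` lbound A) (minimum A).
  by apply: xgetPex; exists x.
by apply/le_anti; rewrite lbm// lbx.
Qed.

Section Simplex.
Context {R : realType} {r : nat}.
Implicit Types (l : 'I_r -> R) (x : 'I_r -> \bar R) (g : R).

Lemma simplex_vertex (i : 'I_r) :
  simplex (fun j : 'I_r => (j == i)%:R : R).
Proof.
split=> [j|]; first by rewrite ler0n.
by rewrite (bigD1 i)//= eqxx big1 ?addr0// => j /negPf ->.
Qed.

Lemma sum_vertex (x : 'I_r -> \bar R) (i : 'I_r) :
  (\sum_j ((j == i)%:R)%:E * x j = x i)%E.
Proof.
rewrite (bigD1 i)//= eqxx mul1e big1 ?adde0// => j /negPf ->.
by rewrite mul0e.
Qed.

Lemma simplex_sum_cst l g : simplex l ->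
  (\sum_i (l i)%:E * g%:E = g%:E)%E.
Proof.
move=> [_ l1]; under eq_bigr do rewrite -EFinM.
by rewrite sumEFin -mulr_suml l1 mul1r.
Qed.

Lemma simplex_sum_le l x g : simplex l -> (forall i, x i <= g%:E)%E ->
  (\sum_i (l i)%:E * x i <= g%:E)%E.
Proof.
move=> hl xg; rewrite -(simplex_sum_cst _ g hl); apply: lee_sum => i _.
by apply: lee_wpmul2l; rewrite ?lee_fin//; case: hl.
Qed.

Lemma simplex_sum_eq l x g : simplex l ->
  (forall i, l i != 0 -> x i = g%:E) -> (\sum_i (l i)%:E * x i = g%:E)%E.
Proof.
move=> hl xg; rewrite -(simplex_sum_cst _ g hl); apply: eq_bigr => i _.
(* With zero weight both terms vanish, even for infinite [x i], since [0 * +oo = 0]. *)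
by have [->|/xg ->//] := eqVneq (l i) 0; rewrite !mul0e.
Qed.

(** The weighted gaps [l j * (g - x j)] are nonnegative and sum to [g - g = 0], so each of them
    vanishes. *)
Lemma simplex_sum_max {l x g} : simplex l ->
  (forall i, 0 <= x i)%E -> (forall i, x i <= g%:E)%E ->
  (\sum_i (l i)%:E * x i = g%:E)%E ->
  forall i, l i != 0 -> x i = g%:E.
Proof.
move=> hl x0 xg sumx i li0.
(* Bounded between [0] and [g], the [x j] are finite, so the gaps can be formed in [R]. *)
have xE j : x j = (fine (x j))%:E.
  by rewrite fineK// ge0_fin_numE// (le_lt_trans (xg j)) ?ltry.
have gap0 j : 0 <= l j * (g - fine (x j)).
  by apply: mulr_ge0; [case: hl | rewrite subr_ge0 -lee_fin -xE].
have : \sum_j l j * (g - fine (x j)) = 0.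
  under eq_bigr do rewrite mulrBr.
  rewrite sumrB -mulr_suml (proj2 hl) mul1r; apply/eqP; rewrite subr_eq0 eq_sym.
  by rewrite -eqe -sumx -sumEFin; apply/eqP/eq_bigr => j _; rewrite EFinM -xE.
move=> /eqP; rewrite psumr_eq0// => /allP /(_ i (mem_index_enum i)) /=.
by rewrite mulf_eq0 (negPf li0) /= subr_eq0 => /eqP ->; rewrite -xE.
Qed.

End Simplex.

Section Game.
Context {R : realType} {n r : nat} {S : scenario R n r}.

(** Attainment makes [G] a genuine minimum instead of the default value of [minimum]. *)
Lemma G_minimum (l : 'I_r -> R) : minima_attained S -> simplex l ->
  (exists2 a, admissible S a & mixed_observability S l a = G S l) /\
  (forall a, admissible S a -> G S l <= mixed_observability S l a).
Proof.
move=> hG /hG[b Ab bmin].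
have GE : G S l = mixed_observability S l b.
  by apply: minimumE => [|_ [c Ac <-]]; [exists b | exact: bmin].
by rewrite GE; split=> //; exists b.
Qed.

(** Positivity is known on the domain only; admissibility keeps the trajectory there over the whole
    range of integration. *)
Lemma cumulative_observability_ge0 (i : 'I_r) (a : R -> 'rV[R]_n) :
  (forall i x, domain S x -> 0 < observability S i x) -> admissible S a ->
  0 <= cumulative_observability S i a.
Proof.
move=> K_pos [_ _ inOmega]; apply: Rintegral_ge0 => t /=.
by rewrite in_itv /= => /inOmega /K_pos/ltW.
Qed.

Lemma mixed_observability_ge0 (l : 'I_r -> R) (a : R -> 'rV[R]_n) :
  (forall i x, domain S x -> 0 < observability S i x) ->
  (forall i, 0 <= l i) -> admissible S a -> 0 <= mixed_observability S l a.
Proof.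
move=> K_pos l_ge0 Aa; apply: sumr_ge0 => i _.
by rewrite mulr_ge0// cumulative_observability_ge0.
Qed.

Context {hA : admissible S !=set0} {F : set (set (strategy hA))}.
Context (K_pos : forall i x, domain S x -> 0 < observability S i x)
  (J_meas : costs_measurable F) (G_attained : minima_attained S).
Implicit Types (l : 'I_r -> R) (theta : mixed_strategy F).

Let J i (w : g_sigma_algebraType F) := cumulative_observability S i (sval w).

Let J_ge0 i w : 0 <= J i w.
Proof. exact/cumulative_observability_ge0/set_valP. Qed.

Lemma expected_observability_ge0 i theta :
  (0 <= expected_observability i theta)%E.
Proof. exact/expectation_ge0/J_ge0. Qed.

Lemma measurable_mixed_observability l :
  measurable_fun [set: g_sigma_algebraType F]
    (fun w : g_sigma_algebraType F => mixed_observability S l (sval w)).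
Proof.
by apply: measurable_sum => i; apply: measurable_funM => //; exact: J_meas.
Qed.

Lemma payoffE l theta : simplex l ->
  payoff l theta = (\sum_i (l i)%:E * expected_observability i theta)%E.
Proof.
move=> [l_ge0 _]; rewrite /payoff /expected_observability unlock.
have mJ i : measurable_fun setT (EFin \o J i).
  by apply/measurable_EFinP; exact: J_meas.
transitivity (\int[theta]_w (\sum_i (l i)%:E * (J i w)%:E))%E.
  by apply: eq_integral => w _; rewrite -sumEFin.
rewrite ge0_integral_sum//.
- apply: eq_bigr => i _; rewrite (ge0_integralZl_EFin _ measurableT)//; last exact: mJ.
  by move=> w _ /=; rewrite lee_fin.
- by move=> i; exact: measurable_funeM (mJ i).
- by move=> i w _; rewrite mule_ge0 ?lee_fin.
Qed.

Lemma G_le_payoff l theta : simplex l -> ((G S l)%:E <= payoff l theta)%E.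
Proof.
move=> hl; have [[a Aa aG] Gmin] := G_minimum l G_attained hl.
rewrite -(expectation_cst theta (G S l)); apply: expectation_le => //.
- exact: measurable_mixed_observability.
(* The constant [G S l] is nonnegative because it is the cost of the admissible control [a]. *)
- by move=> w /=; rewrite -aG mixed_observability_ge0//; case: hl.
- by move=> w; rewrite mixed_observability_ge0//; [case: hl | exact: set_valP].
- by apply: aeW => w; exact/Gmin/set_valP.
Qed.

(** Integrating a measurable function against a Dirac measure is evaluation, whatever the family
    [F]. *)
Lemma payoff_attains_G l : simplex l ->
  exists theta : mixed_strategy F, payoff l theta = (G S l)%:E.
Proof.
move=> hl; have [[a Aa aG] _] := G_minimum l G_attained hl.
pose w : g_sigma_algebraType F := exist _ a (mem_set Aa).
exists (dirac w : probability _ R).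
rewrite /payoff unlock integral_dirac//.
  by rewrite diracT mul1e -aG.
by apply/measurable_EFinP; exact: measurable_mixed_observability.
Qed.

End Game.

Theorem theorem4p2 (R : realType) (n r : nat) (S : scenario R n r)
  (Omega_compact : compact (domain S))
  (source_in : domain S (source S))
  (target_in : domain S (target S))
  (K_pos : forall (i : 'I_r) (x : 'rV[R]_n),
     domain S x -> 0 < observability S i x)
  (traj_wd : trajectories_well_defined S)
  (int_wd : integrals_well_defined S)
  (hA : admissible S !=set0)
  (G_attained : minima_attained S)
  (F : set (set (strategy hA)))
  (J_meas : costs_measurable F)
  (lambda : 'I_r -> R) (hlambda : simplex lambda)
  (theta : mixed_strategy F) :
  nash_equilibrium lambda theta <->
  [/\ (forall l : 'I_r -> R, simplex l -> G S l <= G S lambda),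
      (forall i : 'I_r, active_locations lambda i ->
         expected_observability i theta = (G S lambda)%:E) &
      (forall i : 'I_r, ~ active_locations lambda i ->
         (expected_observability i theta <= (G S lambda)%:E)%E)].
Proof.
set v := G S lambda.
have x_ge0 i := expected_observability_ge0 K_pos i theta.
have PE l := payoffE K_pos J_meas l theta.
split=> [[_ evader_best observer_best]|[_ x_active x_inactive]].
  have Pv : payoff lambda theta = v%:E.
    apply/le_anti; rewrite (G_le_payoff K_pos J_meas)// andbT.
    have [theta' <-] := payoff_attains_G J_meas G_attained lambda hlambda.
    exact: evader_best.
  have x_le i : (expected_observability i theta <= v%:E)%E.
    rewrite -(sum_vertex (fun j => expected_observability j theta)).
    rewrite -PE; last exact: simplex_vertex.
    by rewrite -Pv; apply/observer_best/simplex_vertex.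
  split=> [l hl||i _]; last exact: x_le.
    (* Maximality of [lambda]: [theta] is one possible reply to [l], so [G l <= payoff l theta <=
       payoff lambda theta = v]. *)
    rewrite -lee_fin -/v -Pv; apply: le_trans (observer_best l hl).
    exact: G_le_payoff.
  apply: (simplex_sum_max hlambda x_ge0 x_le).
  by rewrite -PE.
(* Conversely, every location yields at most [v] and the active ones exactly [v]: the payoff is [v],
   no [l] exceeds it against [theta], and no [theta'] goes below [v = G lambda]. *)
have x_le i : (expected_observability i theta <= v%:E)%E.
  by have [/x_active ->//|/x_inactive] := pselect (active_locations lambda i).
have Pv : payoff lambda theta = v%:E by rewrite PE//; exact: simplex_sum_eq.
split=> // [theta'|l hl]; rewrite Pv.
  exact: G_le_payoff.
by rewrite PE//; exact: simplex_sum_le.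
Qed.
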